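(* $r_5(\mathbb{F}_5^3)<74$.
   Context: $r_5(\mathbb{F}_5^3)$ denotes the maximum cardinality of a subset of $\mathbb{F}_5^3$ containing no $5$-progression, i.e. no set $\{a+ib : i\in\{0,1,2,3,4\}\}$ with $a,b\in\mathbb{F}_5^3$, $b\neq 0$; equivalently, containing no full affine line of $\mathbb{F}_5^3$. *)

(* Defs.v *)
From mathcomp Require Import all_boot all_order all_algebra.

Set Implicit Arguments.
Unset Strict Implicit.
Unset Printing Implicit Defensive.

Import GRing.Theory.
Local Open Scope ring_scope.

Definition progression (k p n : nat) (a b : 'rV['F_p]_n) : {set 'rV['F_p]_n} :=
  [set a + b *+ i | i : 'I_k].

Definition progression_free (k p n : nat) (A : {set 'rV['F_p]_n}) : bool :=
  [forall a : 'rV['F_p]_n, forall b : 'rV['F_p]_n,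
    (b != 0) ==> ~~ (progression k a b \subset A)].

(* r_k(F_p^n), meant for p prime and k <= p, so that k-progressions with
   b != 0 have exactly k elements.  For k > 0 the empty set is
   progression-free, so the maximum is attained. *)
Definition r (k p n : nat) : nat :=
  \max_(A : {set 'rV['F_p]_n} | progression_free k A) #|A|.

(* Main.v *)
Require Import Defs.
From HB Require Import structures.
From mathcomp Require Import all_boot all_order all_algebra.
From mathcomp Require Import zify ring.

Set Implicit Arguments.
Unset Strict Implicit.
Unset Printing Implicit Defensive.

Import GRing.Theory.

(** The complement of a line-free set of size 74 is a set [B] of 51 points
    meeting every line of AG(3,5).  Jamison's polynomial argument gives at least
    9 points of [B] in every plane; call the surplus over 9 the excess of the
    plane.  The excesses of a parallel class add up to 6, those of the six planes
    through a line with [j] points of [B] add up to [5 j - 3], and counting pairs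
    of points of [B] shows that the squares of all excesses add up to 978.

    A plane of excess at least 3 contains no line with a single point of [B].
    Bounding, line by line, the squared excesses of the planes meeting it by
    convexity rules out the excesses 3, 4 and 5.  So all excesses are in
    {0, 1, 2, 6}, and the value 978 forces at least 26 heavy planes (excess 6).
    Counting the heavy planes that meet a given one shows that there are exactly
    26 of them and that each contains exactly five full lines (lines inside [B]).
    But every full line lies in exactly three heavy planes, and 3 does not divide
    [26 * 5]. *)

(* A copy of 'F_5 on which the incidence counts below can be decided by
   evaluation. *)
Inductive Z5 := z0 | z1 | z2 | z3 | z4.

Definition nat_of_Z5 x := match x with z0 => 0 | z1 => 1 | z2 => 2 | z3 => 3 | z4 => 4 end.
Definition Z5S x := match x with z0 => z1 | z1 => z2 | z2 => z3 | z3 => z4 | z4 => z0 end.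
Definition Z5_of_nat n := iter n Z5S z0.
Definition Z5add x y :=
  match x with
  | z0 => y | z1 => Z5S y | z2 => Z5S (Z5S y)
  | z3 => Z5S (Z5S (Z5S y)) | z4 => Z5S (Z5S (Z5S (Z5S y)))
  end.
Definition Z5opp x := match x with z0 => z0 | z1 => z4 | z2 => z3 | z3 => z2 | z4 => z1 end.
Definition Z5mul x y :=
  match x with
  | z0 => z0 | z1 => y | z2 => Z5add y y | z3 => Z5opp (Z5add y y) | z4 => Z5opp y
  end.

Lemma nat_of_Z5K : cancel nat_of_Z5 Z5_of_nat. Proof. by case. Qed.
HB.instance Definition _ := Countable.copy Z5 (can_type nat_of_Z5K).

Definition Z5s := [:: z0; z1; z2; z3; z4].
Lemma Z5s_enum : Finite.axiom Z5s. Proof. by case. Qed.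
HB.instance Definition _ := isFinite.Build Z5 Z5s_enum.

Lemma Z5addA : associative Z5add. Proof. by do 3!case. Qed.
Lemma Z5addC : commutative Z5add. Proof. by do 2!case. Qed.
Lemma Z5add0 : left_id z0 Z5add. Proof. by []. Qed.
Lemma Z5addN : left_inverse z0 Z5opp Z5add. Proof. by case. Qed.
HB.instance Definition _ := GRing.isZmodule.Build Z5 Z5addA Z5addC Z5add0 Z5addN.

Lemma Z5mulA : associative Z5mul. Proof. by do 3!case. Qed.
Lemma Z5mulC : commutative Z5mul. Proof. by do 2!case. Qed.
Lemma Z5mul1 : left_id z1 Z5mul. Proof. by []. Qed.
Lemma Z5mulDl : left_distributive Z5mul Z5add. Proof. by do 3!case. Qed.
Lemma Z5_nz : z1 != z0. Proof. by []. Qed.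
HB.instance Definition _ := GRing.Zmodule_isComNzRing.Build Z5 Z5mulA Z5mulC Z5mul1 Z5mulDl Z5_nz.

Lemma big_Z5 (R : Type) (idx : R) (op : Monoid.com_law idx) (F : Z5 -> R) :
  \big[op/idx]_k F k = op (F z0) (op (F z1) (op (F z2) (op (F z3) (F z4)))).
Proof.
have -> : \big[op/idx]_k F k = \big[op/idx]_(k <- Z5s) F k.
  apply: perm_big; apply: uniq_perm; rewrite ?index_enum_uniq // => x.
  by rewrite mem_index_enum; case: x.
by rewrite !big_cons big_nil Monoid.mulm1.
Qed.

(** * Jamison's bound for blocking sets of AG(2,5) *)

Local Open Scope ring_scope.

Lemma sum_pow_Z5 (i : nat) : (i < 4)%N -> \sum_(u : Z5) u ^+ i = 0.
Proof. by move=> Hi; rewrite big_Z5; do 4?[case: i Hi => [|i] Hi //]. Qed.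

(** Expanding one factor raises the degree by at most one, so [i + j + size s] never grows along the
    induction; in the base case one of the exponents is below 4. *)
Lemma sum_monomial_prod (s : seq (Z5 * Z5)) (i j : nat) : (i + j + size s < 8)%N ->
  \sum_(u : Z5) \sum_(v : Z5) u ^+ i * v ^+ j * \prod_(p <- s) (1 - (u * p.1 + v * p.2)) = 0.
Proof.
elim: s i j => [|[x y] s IHs] i j /= Hij.
  under eq_bigr => u _ do [under eq_bigr => v _ do rewrite big_nil mulr1; rewrite -mulr_sumr].
  rewrite -mulr_suml; have [Hi|Hi] := ltnP i 4; first by rewrite sum_pow_Z5 // mul0r.
  by rewrite (@sum_pow_Z5 j) ?mulr0 //; lia.
have E u v : u ^+ i * v ^+ j * \prod_(p <- (x, y) :: s) (1 - (u * p.1 + v * p.2)) =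
   u ^+ i * v ^+ j * \prod_(p <- s) (1 - (u * p.1 + v * p.2))
   - (x * (u ^+ i.+1 * v ^+ j * \prod_(p <- s) (1 - (u * p.1 + v * p.2)))
   + y * (u ^+ i * v ^+ j.+1 * \prod_(p <- s) (1 - (u * p.1 + v * p.2)))).
  by rewrite big_cons /= !exprS; ring.
under eq_bigr => u _ do [under eq_bigr => v _ do rewrite E; rewrite sumrB big_split -!mulr_sumr /=].
rewrite sumrB big_split -!mulr_sumr /= !IHs ?mulr0 ?addr0 ?subr0 //; lia.
Qed.

(* Jamison's argument: for q in S, blocking makes the product of the
   1 - <., p - q> over the other points p of S the indicator function of the
   origin, whose values sum to 1; polynomials of degree less than 8 sum to 0. *)
Lemma blocking_plane_card (S : {set Z5 * Z5}) :
  (forall q d : Z5 * Z5, d != 0 -> exists k, (q.1 + k * d.1, q.2 + k * d.2) \in S) ->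
  (9 <= #|S|)%N.
Proof.
move=> blockS; have [k0] := blockS 0 (1, 0) isT.
set q := (_, _) => Sq; clearbody q.
rewrite leqNgt; apply/negP => ltS9.
pose s := [seq (p.1 - q.1, p.2 - q.2) | p <- enum (S :\ q)].
have sz_s : (0 + 0 + size s < 8)%N.
  by move: ltS9; rewrite (cardsD1 q S) Sq size_map -cardE add1n.
have E u v : (u, v) != 0 -> \prod_(p <- s) (1 - (u * p.1 + v * p.2)) = 0.
  move=> nz.
  have [c Ec] : exists c : Z5 * Z5, u * c.1 + v * c.2 = 1.
    (* Fourth powers are 1 at nonzero elements and 0 at 0. *)
    exists (u ^+ 3 * (1 - v ^+ 4), v ^+ 3) => /=.
    by case: u nz => //; case: v.
  (* This line consists of the [p] with <(u, v), p - q> = 1: a point of [S] on it differs from [q]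
     and makes a factor vanish. *)
  have [|k] := blockS (q.1 + c.1, q.2 + c.2) (- v, u).
    by apply: contraNneq nz => -[/eqP + ->]; rewrite oppr_eq0 => /eqP->.
  move=> /=; set p := (_, _) => Sp.
  have Ep : u * (p.1 - q.1) + v * (p.2 - q.2) = 1 by rewrite -Ec /p /=; ring.
  rewrite (big_rem (p.1 - q.1, p.2 - q.2)) /=; first by rewrite Ep subrr mul0r.
  apply/mapP; exists p => //; rewrite mem_enum !inE Sp andbT.
  by apply: contra_eqN Ep => /eqP ->; rewrite !subrr !mulr0 addr0 eq_sym oner_eq0.
have /eqP := sum_monomial_prod sz_s; apply/negP.
rewrite (bigD1 0) //= [X in _ + X]big1 ?addr0; last first.
  by move=> u nz; rewrite big1 // => v _; rewrite E ?mulr0 // xpair_eqE negb_and nz.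
rewrite (bigD1 0) //= [X in _ + X]big1 ?addr0; last first.
  by move=> v nz; rewrite E ?mulr0 // xpair_eqE negb_and nz orbT.
by rewrite !mulr1 big1 ?oner_eq0 // => p _; rewrite !mul0r addr0 subr0.
Qed.

(** * Planes and lines of AG(3,5) in coordinates *)

Notation V := (Z5 * Z5 * Z5)%type.

Definition dot (n v : V) : Z5 := n.1.1 * v.1.1 + n.1.2 * v.1.2 + n.2 * v.2.
Definition smul (k : Z5) (d : V) : V := (k * d.1.1, k * d.1.2, k * d.2).

Lemma dotC n v : dot n v = dot v n.
Proof. by rewrite /dot; ring. Qed.
Lemma dotD n v w : dot n (v + w) = dot n v + dot n w.
Proof. by rewrite /dot /=; ring. Qed.
Lemma dotB n v w : dot n (v - w) = dot n v - dot n w.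
Proof. by rewrite /dot /=; ring. Qed.
Lemma dotZ n k d : dot n (smul k d) = k * dot n d.
Proof. by rewrite /dot /=; ring. Qed.

(* One normal vector per parallel class of planes, i.e. per point of PG(2,5);
   the same list serves as the list of directions of lines. *)
Definition normals : seq V :=
  (0, 0, 1) :: [seq (0, 1, x) | x <- Z5s] ++ [seq (1, x, y) | x <- Z5s, y <- Z5s].
Definition points : seq V := [seq (p, z) | p <- [seq (x, y) | x <- Z5s, y <- Z5s], z <- Z5s].

Lemma mem_points v : v \in points.
Proof. by move: v => [[[] []] []]. Qed.

Lemma normals_uniq : uniq normals.
Proof. by vm_compute. Qed.

Lemma normals_neq0 n : n \in normals -> n != 0.
Proof. by apply: contraTneq => ->. Qed.

(** For nonzero [w] these normals form a line of PG(2,5), with 6 of the 31 points. *)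
Lemma count_normals_orth w :
  count (fun n => dot n w == 0) normals = (6 + 25 * (w == 0%R))%N.
Proof.
apply/eqP; move: w (mem_points w); apply/allP; vm_compute; reflexivity.
Qed.

(** A multiple of [d] lies in all six planes through 0 and [d], any other [w] in exactly one of
    them. *)
Lemma count_normals_orth2 d w : d \in normals ->
  count (fun n => (dot n d == 0) && (dot n w == 0)) normals =
    (1 + 5 * count (fun k => w == smul k d) Z5s)%N.
Proof.
move=> Nd; apply/eqP; move: w (mem_points w); apply/allP.
move: d Nd; apply/allP; vm_compute; reflexivity.
Qed.

Lemma count_normals_orth_neq n n' : n \in normals -> n' \in normals -> n != n' ->
  count (fun d => (dot d n == 0) && (dot d n' == 0)) normals = 1%N.
Proof.
move=> Nn Nn' neq; rewrite count_normals_orth2 //.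
have: (n == n') || ~~ has (fun k => n' == smul k n) Z5s.
  move: n' {neq} Nn'; apply/allP; move: n Nn; apply/allP; vm_compute; reflexivity.
by rewrite (negbTE neq) has_count -leqNgt leqn0 => /eqP->.
Qed.

(** The six directions in a plane through 0 cover it and share only 0, which is a multiple of all
    six. *)
Lemma sum_multiples n w : n \in normals ->
  (\sum_(d <- normals | dot d n == 0%R) count (fun k => w == smul k d) Z5s)%N =
    (5 * (w == 0%R) + (dot n w == 0%R))%N.
Proof.
move=> Nn; rewrite -big_filter.
rewrite -(big_map (fun d => count (fun k => w == smul k d) Z5s) xpredT id) -sumnE.
apply/eqP; move: w (mem_points w); apply/allP.
move: n Nn; apply/allP; vm_compute; reflexivity.
Qed.

Lemma exists_dual n : n \in normals -> exists w, dot n w = 1.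
Proof.
move=> Nn; suff /hasP[w _ /eqP Hw] : has (fun w => dot n w == 1) points by exists w.
by move: n Nn; apply/allP; vm_compute; reflexivity.
Qed.

Lemma exists_dual2 n n' : n \in normals -> n' \in normals -> n != n' ->
  exists w, dot n w = 0 /\ dot n' w = 1.
Proof.
move=> Nn Nn' neq.
suff: (n == n') || has (fun w => (dot n w == 0) && (dot n' w == 1)) points.
  by rewrite (negbTE neq) => /hasP[w _ /andP[/eqP ? /eqP ?]]; exists w.
move: n' {neq} Nn'; apply/allP; move: n Nn; apply/allP; vm_compute; reflexivity.
Qed.

(** * Sums over planes and a convexity bound *)

Local Open Scope nat_scope.

Lemma sum_nat_count (T : Type) (s : seq T) (P Q : pred T) :
  \sum_(x <- s | P x) (Q x : nat) = count (fun x => P x && Q x) s.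
Proof.
by rewrite -sum1_count [RHS]big_mkcondr /=; apply: eq_bigr => x _; case: (Q x).
Qed.

Lemma sum_nat_delta (T : finType) (g : T -> nat) (u : T) :
  \sum_(v : T) g v * (v == u) = g u.
Proof.
rewrite (bigD1 u) //= eqxx muln1 big1 ?addn0 // => v /negbTE->; exact: muln0.
Qed.

Lemma count_Z5s (P : pred Z5) : count P Z5s = \sum_(k : Z5) P k.
Proof. by rewrite big_Z5 /= addn0. Qed.

Lemma card_Z5 : #|{: Z5}| = 5.
Proof. by rewrite -sum1_card big_Z5. Qed.

Lemma sum_plane_translate n c w (g : V -> nat) : dot n w = 0%R ->
  \sum_(v : V | dot n v == c) g (v + w)%R = \sum_(v : V | dot n v == c) g v.
Proof.
move=> nw; rewrite [RHS](reindex_inj (addIr w)) /=.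
by apply: eq_bigl => v; rewrite dotD nw addr0.
Qed.

(** The five translates of the plane along a dual vector [w] partition the 125 points. *)
Lemma card_plane n c : n \in normals -> \sum_(v : V | dot n v == c) 1 = 25.
Proof.
move=> Nn; have [w nw] := exists_dual Nn.
have E k : \sum_(v : V | dot n v == c) 1 = \sum_(v : V) (k == (c - dot n v)%R).
  rewrite (reindex_inj (addIr (smul k w))) big_mkcond /=; apply: eq_bigr => v _.
  by rewrite dotD dotZ nw mulr1 [k == _]eq_sym subr_eq [c == _]eq_sym addrC; case: eqP.
have: \sum_(k : Z5) \sum_(v : V | dot n v == c) 1 = 125.
  under eq_bigr => k _ do rewrite (E k).
  rewrite exchange_big /=.
  under eq_bigr => v _ do
    [under eq_bigr => k _ do rewrite -[nat_of_bool _]mul1n; rewrite (sum_nat_delta (fun => 1))].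
  by rewrite sum1_card !card_prod card_Z5.
by rewrite sum_nat_const card_Z5; lia.
Qed.

(** Translations along [w] preserve the plane and shift [dot n' v], which therefore takes all values
    equally often. *)
Lemma sum_plane_dot n n' c (g : Z5 -> nat) :
  n \in normals -> n' \in normals -> n != n' ->
  \sum_(v : V | dot n v == c) g (dot n' v) = 5 * \sum_(c' : Z5) g c'.
Proof.
move=> Nn Nn' neq; have [w [nw n'w]] := exists_dual2 Nn Nn' neq.
have E k : \sum_(v : V | dot n v == c) g (dot n' v) =
           \sum_(v : V | dot n v == c) g (dot n' v + k)%R.
  rewrite -(@sum_plane_translate n c (smul k w)) ?dotZ ?nw ?mulr0 //.
  by apply: eq_bigr => v _; rewrite dotD dotZ n'w mulr1.
have: \sum_(k : Z5) \sum_(v : V | dot n v == c) g (dot n' v) = 25 * \sum_(c' : Z5) g c'.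
  under eq_bigr => k _ do rewrite (E k).
  rewrite exchange_big /= -(card_plane c Nn) big_distrl /=; apply: eq_bigr => v _.
  by rewrite mul1n [RHS](reindex_inj (addrI (dot n' v))).
by rewrite sum_nat_const card_Z5; lia.
Qed.

Lemma size_orth d : d \in normals -> \sum_(n' <- normals | dot n' d == 0%R) 1 = 6.
Proof. by move=> Nd; rewrite sum1_count count_normals_orth (negbTE (normals_neq0 Nd)). Qed.

Lemma plane_frame n : n \in normals -> exists d1 d2 e1 e2 : V,
  [/\ dot n d1 = 0, dot n d2 = 0 &
      [/\ dot e1 d1 = 1, dot e1 d2 = 0, dot e2 d1 = 0 & dot e2 d2 = 1]]%R.
Proof.
rewrite inE mem_cat => /orP[/eqP->|/orP[/mapP[x _ ->]|/allpairsP[[x y] [_ _ ->]]]] /=.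
- by exists (1, 0, 0)%R, (0, 1, 0)%R, (1, 0, 0)%R, (0, 1, 0)%R.
- exists (1, 0, 0)%R, (0, - x, 1)%R, (1, 0, 0)%R, (0, 0, 1)%R.
  by rewrite /dot /=; split; last split; ring.
- exists (- x, 1, 0)%R, (- y, 0, 1)%R, (0, 1, 0)%R, (0, 0, 1)%R.
  by rewrite /dot /=; split; last split; ring.
Qed.

(* Convexity: for terms in [0, 6] with a given sum, the sum of squares is
   largest when all terms but one are 0 or 6. *)
Definition max_sum_sq k := 36 * (k %/ 6) + (k %% 6) ^ 2.

Lemma sum_sq_le (T : eqType) (s : seq T) (P : pred T) (f : T -> nat) :
  (forall x, x \in s -> f x <= 6) ->
  \sum_(x <- s | P x) f x ^ 2 <= max_sum_sq (\sum_(x <- s | P x) f x).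
Proof.
move=> f6; rewrite big_seq_cond [X in max_sum_sq X]big_seq_cond.
elim/big_rec2: _ => [//|x k y /andP[/f6 fx _] IH].
apply: leq_trans (leq_add (leqnn _) IH) _; rewrite /max_sum_sq; move: (f x) fx => {IH} e le6.
have -> : e + k = k %/ 6 * 6 + (e + k %% 6) by rewrite {1}(divn_eq k 6) addnCA.
have := ltn_pmod k (isT : 0 < 6); rewrite divnMDl // modnMDl.
move: (k %/ 6) (k %% 6) => q r lt6.
(* Only the remainder [r] of the partial sum interacts with the new term [e]. *)
have: (e ^ 2 + r ^ 2 <= 36 * ((e + r) %/ 6) + ((e + r) %% 6) ^ 2).
  by do 7?[case: e le6 => [|e] le6 //]; do 6?[case: r lt6 => [|r] lt6 //].
lia.
Qed.

Lemma sum_pencil_split n d (g : V -> nat) : n \in normals -> dot n d = 0%R ->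
  \sum_(n' <- normals | dot n' d == 0%R) g n' =
  g n + \sum_(n' <- normals | (dot n' d == 0%R) && (n' != n)) g n'.
Proof.
move=> Nn nd; rewrite big_mkcond (bigD1_seq n) ?normals_uniq //= nd eqxx; congr addn.
by rewrite big_mkcondl.
Qed.

(** * Incidence counts for a blocking set of 51 points *)

Section Counting.

Variable B : pred V.

(* The plane <n, v> = c and the line a + <d> are given by the pairs (n, c) and
   (a, d) with n and d in normals; a line is thus given by five pairs. *)
Definition psize n c := \sum_(v : V | dot n v == c) B v.
Definition lsize a d := \sum_(k : Z5) B (a + smul k d)%R.

Hypothesis cardB : \sum_(v : V) B v = 51.
Hypothesis blockB : forall a d : V, d != 0%R -> exists k, B (a + smul k d)%R.

Lemma lsize_le5 a d : lsize a d <= 5.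
Proof. by rewrite -card_Z5 -sum1_card leq_sum // => k _; case: (B _). Qed.

Lemma sum_psize n : \sum_(c : Z5) psize n c = 51.
Proof.
by rewrite -cardB [RHS](partition_big (dot n) xpredT).
Qed.

(** The six planes through a line cover its points six times and all other points once. *)
Lemma sum_pencil_psize a d : d \in normals ->
  \sum_(n <- normals | dot n d == 0%R) psize n (dot n a) = 51 + 5 * lsize a d.
Proof.
move=> Nd; rewrite /psize; under eq_bigr => n _ do rewrite big_mkcond.
rewrite exchange_big /=.
have E v : \sum_(n <- normals | dot n d == 0%R) (if dot n v == dot n a then B v : nat else 0) =
    B v + 5 * \sum_(k : Z5) B v * (v == a + smul k d)%R.
  transitivity (B v * \sum_(n <- normals | dot n d == 0%R) (dot n (v - a)%R == 0%R)).
    rewrite big_distrr /=; apply: eq_bigr => n _; rewrite dotB subr_eq0.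
    by case: eqP; rewrite ?muln1 ?muln0.
  rewrite sum_nat_count count_normals_orth2 // count_Z5s mulnDr muln1; congr addn.
  rewrite mulnCA big_distrr /=; congr muln; apply: eq_bigr => k _.
  by rewrite subr_eq addrC.
under eq_bigr => v _ do rewrite E.
rewrite big_split /= cardB -big_distrr exchange_big /=; congr (_ + 5 * _).
by apply: eq_bigr => k _; rewrite (sum_nat_delta (fun v => B v : nat)).
Qed.

(** Ordered pairs of points of [B] are weighted by the number of planes containing both, 31 for
    equal points and 6 otherwise; each point contributes [31 + 6 * 50 = 331]. *)
Lemma sum_psize_sq : \sum_(n <- normals) \sum_(c : Z5) psize n c ^ 2 = 331 * 51.
Proof.
have E n : \sum_(c : Z5) psize n c ^ 2 =
    \sum_(v : V) \sum_(w : V) B v * B w * (dot n (v - w)%R == 0%R).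
  rewrite [RHS](partition_big (dot n) xpredT) //=; apply: eq_bigr => c _.
  rewrite -mulnn {1}/psize big_distrl /=; apply: eq_bigr => v /eqP <-.
  rewrite /psize big_distrr big_mkcond /=; apply: eq_bigr => w _.
  by rewrite dotB subr_eq0 eq_sym; case: eqP; rewrite ?muln1 ?muln0.
under eq_bigr => n _ do rewrite E.
rewrite exchange_big /=.
have E2 v : \sum_(n <- normals) \sum_(w : V) B v * B w * (dot n (v - w)%R == 0%R) = 331 * B v.
  rewrite exchange_big /=.
  transitivity (\sum_(w : V) (6 * B v * B w + 25 * B v * (B w * (w == v)))).
    apply: eq_bigr => w _; rewrite -big_distrr /= sum_nat_count.
    rewrite [count _ _](count_normals_orth (v - w)%R).
    by rewrite subr_eq0 [v == w]eq_sym; lia.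
  rewrite big_split /= -!big_distrr /= cardB (sum_nat_delta (fun v => B v : nat)).
  by case: (B v).
by under eq_bigr => v _ do rewrite E2; rewrite -big_distrr /= cardB.
Qed.

(* Every line of the plane counts five times, once for each of its points. *)
Definition sum_lines n c (F : V -> V -> nat) :=
  \sum_(a : V | dot n a == c) \sum_(d <- normals | dot d n == 0%R) F a d.

Section Plane.

Variables (n : V) (c : Z5).
Hypothesis Nn : n \in normals.

Lemma sum_linesD F G :
  sum_lines n c (fun a d => F a d + G a d) = sum_lines n c F + sum_lines n c G.
Proof. by rewrite /sum_lines -big_split; apply: eq_bigr => a _; rewrite -big_split. Qed.

Lemma sum_linesM k F : sum_lines n c (fun a d => k * F a d) = k * sum_lines n c F.
Proof. by rewrite /sum_lines big_distrr; apply: eq_bigr => a _; rewrite big_distrr. Qed.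

Lemma sum_lines_le F G :
  (forall a d, dot n a = c -> d \in normals -> dot d n = 0%R -> F a d <= G a d) ->
  sum_lines n c F <= sum_lines n c G.
Proof.
move=> leFG; apply: leq_sum => a /eqP na.
rewrite [X in X <= _]big_seq_cond [X in _ <= X]big_seq_cond.
by apply: leq_sum => d /andP[Nd /eqP dn]; apply: leFG.
Qed.

Lemma sum_lines_1 : sum_lines n c (fun _ _ => 1) = 150.
Proof.
rewrite /sum_lines size_orth // (eq_bigr (fun=> 6 * 1)) // -big_distrr /= card_plane //.
Qed.

Lemma sum_lines_lsize :
  sum_lines n c lsize = 30 * psize n c.
Proof.
rewrite /sum_lines exchange_big /=.
transitivity (\sum_(d <- normals | dot d n == 0%R) 5 * psize n c * 1); last first.
  by rewrite -big_distrr /= size_orth //; lia.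
apply: eq_bigr => d /eqP dn; rewrite /lsize exchange_big /=.
transitivity (\sum_(k : Z5) psize n c); last by rewrite sum_nat_const card_Z5 muln1.
apply: eq_bigr => k _; rewrite (@sum_plane_translate n c (smul k d) (fun v => B v : nat)) //.
by rewrite dotZ dotC dn mulr0.
Qed.

(** Two distinct points of the plane lie on one of its lines, a repeated point on six: with m points
    of [B] this gives [m * (m - 1) + 6 * m] pairs. *)
Lemma sum_lines_lsize_sq :
  sum_lines n c (fun a d => lsize a d ^ 2) = 5 * (psize n c * (psize n c + 5)).
Proof.
rewrite /sum_lines.
(* A line with [j] points contributes [5 * j ^ 2] on the left, while [B a * j] summed over its
   points is [j ^ 2]. *)
transitivity (5 * \sum_(a : V | dot n a == c) \sum_(d <- normals | dot d n == 0%R) B a * lsize a d).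
  rewrite exchange_big [in RHS]exchange_big big_distrr /=; apply: eq_bigr => d /eqP dn.
  transitivity (\sum_(k : Z5) \sum_(a : V | dot n a == c) B a * lsize a d); last first.
    by rewrite sum_nat_const card_Z5.
  rewrite exchange_big /=.
  transitivity (\sum_(a : V | dot n a == c) \sum_(k : Z5)
                  B (a + smul k d)%R * lsize (a + smul k d)%R d).
    apply: eq_bigr => a _; rewrite -mulnn {1}/lsize big_distrl /=; apply: eq_bigr => k _.
    congr muln; rewrite /lsize (reindex_inj (addrI k)) /=; apply: eq_bigr => l _.
    congr (nat_of_bool (B _)); rewrite -addrA; congr (_ + _)%R.
    by congr (_, _, _) => /=; ring.
  rewrite exchange_big [in RHS]exchange_big /=; apply: eq_bigr => k _.
  rewrite (@sum_plane_translate n c (smul k d) (fun v => B v * lsize v d)) //.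
  by rewrite dotZ dotC dn mulr0.
congr muln; rewrite {1}/psize big_distrl /=; apply: eq_bigr => a /eqP nac.
rewrite -big_distrr /=.
have -> : \sum_(d <- normals | dot d n == 0%R) lsize a d = psize n c + 5 * B a.
  transitivity (\sum_(w : V) B w *
      \sum_(d <- normals | dot d n == 0%R) count (fun k => (w - a)%R == smul k d) Z5s).
    under [RHS]eq_bigr => w _ do rewrite big_distrr.
    rewrite [RHS]exchange_big; apply: eq_bigr => d _.
    under [RHS]eq_bigr => w _ do rewrite count_Z5s big_distrr /=.
    rewrite [RHS]exchange_big /=; apply: eq_bigr => k _.
    rewrite -[LHS](sum_nat_delta (fun v => B v : nat)); apply: eq_bigr => w _.
    by rewrite subr_eq addrC.
  under eq_bigr => w _ do rewrite sum_multiples // mulnDr mulnCA.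
  rewrite big_split /= -big_distrr /= addnC; congr addn.
    rewrite /psize [RHS]big_mkcond; apply: eq_bigr => w _.
    by rewrite dotB nac subr_eq0; case: eqP; rewrite ?muln1 ?muln0.
  congr muln; rewrite -[RHS](sum_nat_delta (fun v => B v : nat)); apply: eq_bigr => w _.
  by rewrite subr_eq0.
by case: (B a).
Qed.

(* Each plane not parallel to (n, c) meets it in exactly one line. *)
Lemma sum_lines_pencils (g : V -> Z5 -> nat) :
  sum_lines n c (fun a d =>
    \sum_(n' <- normals | (dot n' d == 0%R) && (n' != n)) g n' (dot n' a)) =
  5 * \sum_(n' <- normals | n' != n) \sum_(c' : Z5) g n' c'.
Proof.
rewrite /sum_lines.
transitivity (\sum_(a : V | dot n a == c) \sum_(n' <- normals | n' != n) g n' (dot n' a)).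
  apply: eq_bigr => a _; under eq_bigr => d _ do rewrite big_mkcondl /=.
  rewrite exchange_big /= big_seq_cond [RHS]big_seq_cond.
  apply: eq_bigr => n' /andP[Nn' neq].
  transitivity (g n' (dot n' a) * \sum_(d <- normals | dot d n == 0%R) (dot d n' == 0%R)).
    rewrite big_distrr /=; apply: eq_bigr => d _; rewrite (dotC n' d).
    by case: eqP; rewrite ?muln1 ?muln0.
  by rewrite sum_nat_count count_normals_orth_neq ?muln1 // eq_sym.
rewrite exchange_big big_distrr /= big_seq_cond [RHS]big_seq_cond.
by apply: eq_bigr => n' /andP[Nn' neq]; rewrite sum_plane_dot // eq_sym.
Qed.

End Plane.

(** * Excesses of planes *)

Lemma psize_ge9 n c : n \in normals -> 9 <= psize n c.
Proof.
move=> Nn; have [w nw] := exists_dual Nn.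
have [d1 [d2 [e1 [e2 [nd1 nd2 [e11 e12 e21 e22]]]]]] := plane_frame Nn.
(* An affine parametrization of the plane, with coordinates read off by [e1] and [e2]; it maps lines
   to lines, so the preimage of [B] is blocking. *)
pose f (p : Z5 * Z5) := (smul c w + smul p.1 d1 + smul p.2 d2)%R.
have fI : injective f.
  move=> [s t] [s' t'] /(congr1 (fun v => (dot e1 v, dot e2 v))).
  rewrite !dotD !dotZ e11 e12 e21 e22 /= !mulr0 !mulr1 !addr0 => -[] /addrI ->.
  by move/addrI ->.
pose S := [set p | B (f p)].
have: 9 <= #|S|.
  apply: blocking_plane_card => q d nzd.
  have [|k Bk] := blockB (f q) (d := smul d.1 d1 + smul d.2 d2)%R.
    apply: contraNneq nzd => E0.
    have := congr1 (dot e1) E0; have := congr1 (dot e2) E0.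
    rewrite !dotD !dotZ e11 e12 e21 e22 !mulr0 !mulr1 addr0 add0r.
    have dot0 e : dot e 0%R = 0%R by rewrite /dot /= !mulr0 !addr0.
    by rewrite !dot0; case: d {E0} => ? ? /= -> ->.
  exists k; rewrite inE; move: Bk; congr (is_true (B _)).
  by rewrite /f /=; congr (_, _, _) => /=; ring.
move/leq_trans; apply; rewrite -(card_imset _ fI) /psize.
have -> : \sum_(v : V | dot n v == c) B v = #|[set v : V | (dot n v == c) && B v]|.
  rewrite -sum1_card.
  rewrite [RHS]big_mkcond [LHS]big_mkcond; apply: eq_bigr => v _.
  by rewrite inE; case: eqP; case: (B v).
apply/subset_leq_card/subsetP => _ /imsetP[p + ->]; rewrite !inE => ->.
by rewrite !dotD !dotZ nw nd1 nd2 !mulr0 mulr1 !addr0 eqxx.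
Qed.

(** The truncated subtraction is exact for [n] in [normals], by [psize_ge9]. *)
Definition excess n c := psize n c - 9.

Lemma psizeE n c : n \in normals -> psize n c = excess n c + 9.
Proof. by move=> Nn; rewrite subnK ?psize_ge9. Qed.

Lemma sum_excess n : n \in normals -> \sum_(c : Z5) excess n c = 6.
Proof.
move=> Nn; have := sum_psize n; under eq_bigr => c _ do rewrite psizeE //.
by rewrite big_split /= sum_nat_const card_Z5; lia.
Qed.

Lemma excess_le6 n c : n \in normals -> excess n c <= 6.
Proof. by move=> Nn; rewrite -(sum_excess Nn) (bigD1 c) //= leq_addr. Qed.

Lemma sum_pencil_excess a d : d \in normals ->
  \sum_(n <- normals | dot n d == 0%R) excess n (dot n a) + 3 = 5 * lsize a d.
Proof.
move=> Nd; have := sum_pencil_psize a Nd.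
rewrite big_seq_cond; under eq_bigr => n /andP[Nn _] do rewrite psizeE // -[9]muln1.
by rewrite big_split /= -!big_seq_cond -big_distrr /= size_orth //; lia.
Qed.

Lemma sum_excess_sq : \sum_(n <- normals) \sum_(c : Z5) excess n c ^ 2 = 978.
Proof.
have := sum_psize_sq.
have -> : \sum_(n <- normals) \sum_(c : Z5) psize n c ^ 2 =
    (* Here [513 = 18 * 6 + 5 * 81], from expanding [(e + 9) ^ 2] over a parallel class. *)
    \sum_(n <- normals) (\sum_(c : Z5) excess n c ^ 2 + 513 * 1).
  rewrite big_seq [RHS]big_seq; apply: eq_bigr => n Nn.
  transitivity (\sum_(c : Z5) (excess n c ^ 2 + (18 * excess n c + 81))).
    by apply: eq_bigr => c _; rewrite psizeE //; lia.
  by rewrite big_split /= big_split /= -big_distrr /= sum_excess // sum_nat_const card_Z5.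
rewrite big_split /= -big_distrr /= sum1_size; change (size normals) with 31; lia.
Qed.

(** The planes not parallel to a plane of excess 3, 4 or 5 carry nearly all of the 978; a bound
    quadratic in the line size, summed over the lines of the plane, allows less. *)
Lemma excess_le2_or_6 n c : n \in normals -> (excess n c <= 2) || (excess n c == 6).
Proof.
move=> Nn; have le6 := excess_le6 c Nn.
apply/norP => -[]; rewrite -ltnNge => gt2 /eqP neq6.
set e0 := excess n c in le6 gt2 neq6.
(* j ^ 2 + (18 + 2 * e0) * j - A is at least max_sum_sq (5 * j - 3 - e0) for
   j = 2, ..., 5, with equality for j = 2, 3, 4. *)
pose A := nth 0 [:: 36; 47; 56] (e0 - 3).
pose Q a d := \sum_(n' <- normals | (dot n' d == 0%R) && (n' != n)) excess n' (dot n' a) ^ 2.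
have QP : sum_lines n c (fun a d => Q a d + A * 1) <=
          sum_lines n c (fun a d => lsize a d ^ 2 + (18 + 2 * e0) * lsize a d).
  apply: sum_lines_le => a d na Nd; rewrite dotC => nd.
  have := sum_pencil_excess a Nd; have := lsize_le5 a d.
  rewrite (sum_pencil_split _ Nn nd) na -/e0.
  have: Q a d <= _ := sum_sq_le _ (fun n' Nn' => excess_le6 _ Nn').
  set s := \sum_(n' <- _ | _) _; set j := lsize a d; move: (Q a d) => q.
  rewrite /A; clearbody s j e0; move=> leq j5 Es.
  (* For [j <= 1] the excesses of the pencil could add up to at most 2, but [e0] alone is larger. *)
  have j2 : 2 <= j by lia.
  have {}Es : s = 5 * j - 3 - e0 by lia.
  rewrite {}Es in leq; apply: leq_trans (leq_add leq (leqnn _)) _ => {leq}.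
  have: (e0 == 3) || (e0 == 4) || (e0 == 5) by lia.
  have: (j == 2) || (j == 3) || (j == 4) || (j == 5) by lia.
  move=> {gt2 le6 neq6 j2 j5}.
  by do 3?[case/orP]; move=> /eqP->; do 2?[case/orP]; move=> /eqP->.
move: QP; rewrite !sum_linesD !sum_linesM sum_lines_1 // sum_lines_lsize // sum_lines_lsize_sq //.
rewrite (sum_lines_pencils c Nn (fun n' c' => excess n' c' ^ 2)).
have := sum_excess_sq; rewrite (bigD1_seq n) ?normals_uniq //=.
have : \sum_(c' : Z5) excess n c' ^ 2 <= e0 ^ 2 + max_sum_sq (6 - e0).
  rewrite -[X in X - e0](sum_excess Nn) [X in X - e0](bigD1 c) //= -/e0 addKn.
  rewrite (bigD1 c) //= leq_add2l.
  by apply: sum_sq_le => c' _; exact: excess_le6.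
have e345 : (e0 == 3) || (e0 == 4) || (e0 == 5) by lia.
have -> : max_sum_sq (6 - e0) = nth 0 [:: 9; 4; 1] (e0 - 3).
  by move: e345; do 2?[case/orP]; move=> /eqP->.
rewrite psizeE // -/e0 /A; set X := \sum_(c' : Z5) excess n c' ^ 2.
set Y := \sum_(n' <- normals | n' != n) _.
by move: e345; do 2?[case/orP]; move=> /eqP-> /=; lia.
Qed.

(** * Heavy planes and full lines *)

Definition heavy n c := excess n c == 6.
Definition full a d := lsize a d == 5.

Lemma excess_heavy_le n c : n \in normals ->
  (6 * heavy n c <= excess n c <= 2 + 4 * heavy n c).
Proof.
by move=> Nn; have := excess_le2_or_6 c Nn; rewrite /heavy; case: eqP => [->//|_]; rewrite orbF.
Qed.

(** An excess e in {0, 1, 2, 6} satisfies [e ^ 2 <= 2 * e + 24 * heavy]; summing, 978 is at most 372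
    plus 24 times the number of heavy planes. *)
Lemma num_heavy_ge : 26 <= \sum_(n <- normals) \sum_(c : Z5) heavy n c.
Proof.
have: \sum_(n <- normals) \sum_(c : Z5) excess n c ^ 2 <=
    \sum_(n <- normals) (12 * 1 + 24 * \sum_(c : Z5) heavy n c).
  rewrite big_seq [X in _ <= X]big_seq; apply: leq_sum => n Nn.
  apply: (@leq_trans (\sum_(c : Z5) (2 * excess n c + 24 * heavy n c))).
    apply: leq_sum => c _; have := excess_le2_or_6 c Nn; rewrite /heavy.
    by case: eqP => [->//|_]; rewrite orbF; nia.
  by rewrite big_split /= -!big_distrr /= sum_excess.
by rewrite sum_excess_sq big_split /= -!big_distrr /= sum1_size; change (size normals) with 31; lia.
Qed.

Lemma sum_heavy_class n c : n \in normals -> heavy n c -> \sum_(c' : Z5) heavy n c' = 1.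
Proof.
move=> Nn Hc; have: \sum_(c' : Z5) 6 * heavy n c' <= \sum_(c' : Z5) excess n c'.
  by apply: leq_sum => c' _; case/andP: (excess_heavy_le c' Nn).
by rewrite sum_excess // -big_distrr /= (bigD1 c) //= Hc; lia.
Qed.

Lemma sum_pencil_heavy_bounds a (P : pred V) :
  let s := \sum_(n <- normals | P n) excess n (dot n a) in
  let h := \sum_(n <- normals | P n) heavy n (dot n a) in
  6 * h <= s <= 2 * (\sum_(n <- normals | P n) 1) + 4 * h.
Proof.
rewrite /= !big_distrr -big_split /=; apply/andP; split;
  rewrite [X in X <= _]big_seq_cond [X in _ <= X]big_seq_cond;
  by apply: leq_sum => n /andP[Nn _]; case/andP: (excess_heavy_le (dot n a) Nn).
Qed.

(** For h heavy planes among the six, whose excesses add up to 22, [6 * h <= 22 <= 12 + 4 * h]. *)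
Lemma full_heavy a d : d \in normals -> full a d ->
  \sum_(n <- normals | dot n d == 0%R) heavy n (dot n a) = 3.
Proof.
move=> Nd /eqP Ef; have := sum_pencil_heavy_bounds a (fun n => dot n d == 0%R).
have := sum_pencil_excess a Nd; rewrite Ef size_orth //=; lia.
Qed.

(** Write T for [sum_lines n c full] and x for the number of heavy planes. Since the plane has 15
    points, [I1] and [I2] become [10 * (x - 1) <= 150 + 4 * T] and [T <= 25], so [x >= 26] forces
    equality. The value 25 stands for five full lines, each counted five times. *)
Lemma heavy_plane n c : n \in normals -> heavy n c ->
  \sum_(n' <- normals) \sum_(c' : Z5) heavy n' c' = 26 /\ sum_lines n c full = 25.
Proof.
move=> Nn Hc; have Ec : excess n c = 6 by apply/eqP.
pose h a d := \sum_(n' <- normals | (dot n' d == 0%R) && (n' != n)) heavy n' (dot n' a).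
have bounds a d : dot n a = c -> d \in normals -> dot d n = 0%R ->
    [/\ 2 <= lsize a d, lsize a d <= 5 & 6 * h a d + 9 <= 5 * lsize a d].
  move=> na Nd; rewrite dotC => nd; have := lsize_le5 a d.
  have := sum_pencil_heavy_bounds a (fun n' => (dot n' d == 0%R) && (n' != n)).
  have := sum_pencil_excess a Nd; rewrite (sum_pencil_split _ Nn nd) na Ec /= -/(h a d).
  move: (\sum_(n' <- normals | _) excess _ _) => s; move: (h a d) (lsize a d) => x y.
  by move=> Es /andP[lehs _] ?; split; lia.
(* In terms of j = 2, 3, 4, 5, the tuple (0, 1, 1, 2) bounds h, and (0, 0, 1, 3)
   are the values of (j - 2) * (j - 3) / 2. *)
have I1 : sum_lines n c (fun a d => 2 * h a d + (lsize a d ^ 2 + 10 * 1)) <=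
          sum_lines n c (fun a d => 7 * lsize a d + 4 * full a d).
  apply: sum_lines_le => a d na Nd nd; have [] := bounds a d na Nd nd; rewrite /full.
  move: (h a d) (lsize a d) => x; do 6?[case=> [|] //=]; lia.
have I2 : sum_lines n c (fun a d => 5 * lsize a d + 6 * full a d) <=
          sum_lines n c (fun a d => lsize a d ^ 2 + 6 * 1).
  apply: sum_lines_le => a d na Nd nd; have [] := bounds a d na Nd nd; rewrite /full.
  move: (lsize a d); do 6?[case=> [|] //=]; lia.
have := num_heavy_ge; move: I1 I2; rewrite !sum_linesD !sum_linesM.
rewrite sum_lines_1 // sum_lines_lsize // sum_lines_lsize_sq // psizeE // Ec.
rewrite (sum_lines_pencils c Nn (fun n' c' => heavy n' c' : nat)).
rewrite (bigD1_seq n) ?normals_uniq //= (sum_heavy_class Nn Hc).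
by set X := \sum_(n' <- normals | n' != n) _; move: (sum_lines n c _) => T; lia.
Qed.

(** Double counting of the incidences between heavy planes and full lines, every line with its five
    base points, would make [25 * 26] a multiple of 3. *)
Lemma no_blocking_set_51 : False.
Proof.
set x := \sum_(n <- normals) \sum_(c : Z5) heavy n c.
have x26 : x = 26.
  have := num_heavy_ge; rewrite -/x => x_ge.
  have [n Nn [c Hc]] : exists2 n, n \in normals & exists c, heavy n c.
    have /hasP[n Nn /existsP Hn] : has (fun n => [exists c, heavy n c]) normals.
      apply: contraLR x_ge => /hasPn no; rewrite /x big_seq big1 // => n Nn.
      rewrite big1 // => c _; move: (no n Nn); rewrite negb_exists => /forallP/(_ c).
      by case: (heavy n c).
    by exists n.
  by have [] := heavy_plane Nn Hc.
have: \sum_(n <- normals) \sum_(c : Z5) heavy n c * sum_lines n c full = 25 * x.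
  rewrite /x big_distrr /= big_seq [RHS]big_seq; apply: eq_bigr => n Nn.
  rewrite big_distrr /=; apply: eq_bigr => c _; case Hc: (heavy n c) => //.
  by have [_ ->] := heavy_plane Nn Hc.
have -> : \sum_(n <- normals) \sum_(c : Z5) heavy n c * sum_lines n c full =
    \sum_(a : V) \sum_(d <- normals)
      full a d * \sum_(n <- normals | dot n d == 0%R) heavy n (dot n a).
  transitivity (\sum_(n <- normals) \sum_(a : V)
      \sum_(d <- normals | dot d n == 0%R) full a d * heavy n (dot n a)).
    apply: eq_bigr => n _; rewrite [RHS](partition_big (dot n) xpredT) //=.
    apply: eq_bigr => c _; rewrite big_distrr /=; apply: eq_bigr => a /eqP ->.
    by rewrite big_distrr /=; apply: eq_bigr => d _; rewrite mulnC.
  rewrite exchange_big /=; apply: eq_bigr => a _.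
  under [RHS]eq_bigr => d _ do rewrite big_distrr /=.
  under [RHS]eq_bigr => d _ do rewrite big_mkcond /=.
  rewrite [RHS]exchange_big /=; apply: eq_bigr => n _.
  by rewrite big_mkcond; apply: eq_bigr => d _; rewrite dotC.
have -> : \sum_(a : V) \sum_(d <- normals)
      full a d * \sum_(n <- normals | dot n d == 0%R) heavy n (dot n a) =
    3 * \sum_(a : V) \sum_(d <- normals) full a d.
  rewrite big_distrr /=; apply: eq_bigr => a _; rewrite big_distrr /= big_seq [RHS]big_seq.
  apply: eq_bigr => d Nd; case Hf: (full a d) => //.
  by rewrite full_heavy.
rewrite x26; lia.
Qed.

End Counting.

(** * Transfer to row vectors over ['F_5] *)

Definition F5_of_Z5 (x : Z5) : 'F_5 := (nat_of_Z5 x)%:R.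

Lemma F5_of_Z5D x y : F5_of_Z5 (x + y)%R = (F5_of_Z5 x + F5_of_Z5 y)%R.
Proof. by apply: val_inj; case: x; case: y. Qed.

Lemma F5_of_Z5_inj : injective F5_of_Z5.
Proof. by move=> x y /(congr1 val); case: x; case: y. Qed.

Definition row_of_point (v : V) : 'rV['F_5]_3 :=
  \row_(i < 3) F5_of_Z5 (tnth [tuple v.1.1; v.1.2; v.2] i).

Lemma row_of_point_inj : injective row_of_point.
Proof.
move=> [[x y] z] [[x' y'] z'] /rowP E.
have:= E (inord 0); have:= E (inord 1); have:= E (inord 2).
by rewrite !mxE !(tnth_nth 0%R) !inordK //= => /F5_of_Z5_inj-> /F5_of_Z5_inj-> /F5_of_Z5_inj->.
Qed.

Lemma row_of_pointD v w : row_of_point (v + w)%R = (row_of_point v + row_of_point w)%R.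
Proof.
by apply/rowP => i; rewrite !mxE -F5_of_Z5D; case: i => [[|[|[|//]]] ?].
Qed.

(** Matches the terms [b *+ i] of a progression with the points of a line over [Z5]. *)
Lemma row_of_point_smul m d : row_of_point (smul m%:R%R d) = (row_of_point d *+ m)%R.
Proof.
elim: m => [|m IHm].
  by apply/rowP => i; rewrite mulr0n !mxE; case: i => [[|[|[|//]]] ?]; apply: val_inj.
rewrite [RHS]mulrSr -IHm -row_of_pointD; congr row_of_point.
by rewrite -natr1; congr (_, _, _) => /=; ring.
Qed.

Lemma row_of_point_bij : bijective row_of_point.
Proof.
apply: inj_card_bij; first exact: row_of_point_inj.
by rewrite card_mx card_Fp // !card_prod card_Z5.
Qed.

Theorem theorem1p5 : (r 5 5 3 < 74)%N.
Proof.
rewrite ltnS; apply/bigmax_leqP => A freeA; rewrite leqNgt.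
(* Exactly 74 points of [A] are kept, so that the complement has exactly 51 points. *)
apply/negP => /card_geqP[s [uniq_s size_s subsA]].
apply: (@no_blocking_set_51 (fun v => row_of_point v \notin s)) => [|a d nz_d].
  have Es : #|[set v | row_of_point v \in s]| = 74.
    rewrite -size_s -(card_uniqP uniq_s) -[RHS](on_card_preimset (onW_bij _ row_of_point_bij)).
    by apply: eq_card => v; rewrite !inE.
  have := cardsC [set v | row_of_point v \in s]; rewrite Es !card_prod card_Z5.
  have -> : #|~: [set v | row_of_point v \in s]| = \sum_(v : V) (row_of_point v \notin s).
    by rewrite -sum1_card big_mkcond; apply: eq_bigr => v _; rewrite !inE; case: (_ \in s).
  lia.
move: freeA => /forallP/(_ (row_of_point a))/forallP/(_ (row_of_point d))/implyP.
have nz : row_of_point d != 0%R.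
  apply: contraNneq nz_d => d0; apply/eqP/row_of_point_inj; rewrite d0.
  by apply: (addrI (row_of_point 0%R)); rewrite -row_of_pointD !addr0.
move=> /(_ nz)/subsetPn[_ /imsetP[i _ ->] notA]; exists i%:R%R.
by rewrite row_of_pointD row_of_point_smul; apply: contra notA => /subsA.
Qed.
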